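(* Let $\mu$ be the distribution of the Stern-Brocot (Farey) fractions on $[0,1]$, i.e. the measure on $[0,1]$ with $\int_a^b d\mu = \Pr[a\le X<b]=\lim_{N\to\infty}\Pr[a\le X_N<b]$, where $X_N$ is chosen uniformly at random from the fractions in the first $N$ rows of the Stern-Brocot tree of the unit interval. Then the integral of $\mu$ is the Minkowski Question Mark function: for all $0\le a\le b\le 1$, $$?(b)-?(a)=\int_a^b d\mu .$$
   Context: The Minkowski Question Mark function $?:[0,1]\to[0,1]$ is defined as follows. For rational $x\in[0,1]$ with finite continued fraction $x=[0;a_1,a_2,\dots,a_N]=\cfrac{1}{a_1+\cfrac{1}{a_2+\cdots}}$ (positive integers $a_k$), $?(x)=2\sum_{k=1}^{N}(-1)^{k+1}2^{-(a_1+a_2+\cdots+a_k)}$ (with $?(0)=0$, $?(1)=1$). For irrational $x=[0;a_1,a_2,\dots]$ one takes the limit $N\to\infty$ of this sum. The function is continuous and strictly increasing. The Stern-Brocot (Farey) tree of the unit interval is the infinite binary tree of rationals in $(0,1)$ whose root row is $\{1/2\}$ and in which row $n$ (for $n\ge 0$) consists of the $2^n$ fractions obtained by applying all length-$n$ compositions of the two maps $y\mapsto \frac{y}{1+y}$ and $y\mapsto\frac{1}{2-y}$ to $1/2$ (so row $1$ is $\{1/3,2/3\}$, row $2$ is $\{1/4,2/5,3/5,3/4\}$, etc.). Every rational in $(0,1)$ occurs exactly once. The ''first $N$ rows'' are rows $0,1,\dots,N-1$. The random variable $X_N$ is uniformly distributed on the fractions of the first $N$ rows, and $X=\lim_{N\to\infty}X_N$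 is understood in the sense of distributions. *)

(* Defs.v *)
From HB Require Import structures.
From mathcomp Require Import all_boot all_order all_algebra.
From mathcomp Require Import all_classical all_reals all_analysis.
From mathcomp Require Import ring lra.

Set Implicit Arguments.
Unset Strict Implicit.
Unset Printing Implicit Defensive.

Import Order.TTheory GRing.Theory Num.Theory.
Import numFieldNormedType.Exports.

Local Open Scope classical_set_scope.
Local Open Scope ring_scope.

(* Here 0^-1 = 0, so 0 is a fixed point of gauss: the expansion of x has
   ended as soon as the remainder iter k gauss x vanishes. *)
Definition gauss (R : realType) (x : R) : R := x^-1 - (Num.truncn x^-1)%:R.

(* The digit a_(k+1) of x = [0; a_1, a_2, ...] for x in [0, 1];
   it is 0 when the expansion of x has at most k digits. *)
Definition partial_quotient (R : realType) (x : R) (k : nat) : nat :=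
  Num.truncn (iter k (@gauss R) x)^-1.

Definition question_mark_term (R : realType) (x : R) (k : nat) : R :=
  if partial_quotient x k == 0%N then 0
  else (-1) ^+ k * 2^-1 ^+ (\sum_(i < k.+1) partial_quotient x i)%N.

(* The Minkowski question mark function. For rational x the terms vanish once
   the expansion has ended, so the limit is a finite sum; see
   question_mark_contfrac below. *)
Definition question_mark (R : realType) (x : R) : R :=
  2 * limn (series (question_mark_term x)).

(* Row n of the Stern-Brocot tree of the unit interval. *)
Fixpoint farey_row (R : realType) (n : nat) : seq R :=
  if n is m.+1 then [seq y / (1 + y) | y <- farey_row R m]
                    ++ [seq (2 - y)^-1 | y <- farey_row R m]
  else [:: 2^-1].

Definition farey_rows (R : realType) (N : nat) : seq R :=
  flatten [seq farey_row R n | n <- iota 0 N].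

(* Pr[X_N \in E] for X_N uniform on the first N rows. No fraction occurs twice
   in farey_rows R N; the value at N = 0 is meaningless. *)
Definition farey_prob (R : realType) (N : nat) (E : pred R) : R :=
  (count E (farey_rows R N))%:R / (size (farey_rows R N))%:R.

(* mu is the law of X = lim X_N, a probability measure on the Borel sets of the
   line carried by [0, 1]. *)
Definition farey_distribution (R : realType)
    (mu : probability (measurableTypeR R) R) : Prop :=
  mu `[0, 1]%classic = 1%E /\
  forall a b : R, 0 <= a -> a <= b -> b <= 1 ->
    (farey_prob N (fun x : R => a <= x < b))%:E @[N --> \oo] --> mu `[a, b[%classic.

(* The finite continued fraction [0; a_1, ..., a_N]. *)
Definition contfrac (R : realType) (s : seq nat) : R :=
  foldr (fun a y => (a%:R + y)^-1) 0 s.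

Lemma partial_quotientS (R : realType) (x : R) k :
  partial_quotient x k.+1 = partial_quotient (gauss x) k.
Proof. by rewrite /partial_quotient iterSr. Qed.

Lemma partial_quotient_cons (R : realType) (a : nat) (y : R) :
  0 <= y < 1 ->
  partial_quotient (a%:R + y)^-1 0 = a /\ gauss (a%:R + y)^-1 = y.
Proof.
move=> /andP[y0 y1]; rewrite /partial_quotient /gauss /= invrK.
suff -> : Num.truncn (a%:R + y) = a by split=> //; ring.
apply/eqP; rewrite truncn_eq ?addr_ge0// lerDl y0 /=.
by rewrite -natr1 ltrD2l.
Qed.

Lemma question_mark_sum_cons (R : realType) (a : nat) (y : R) N :
  (0 < a)%N -> 0 <= y < 1 ->
  series (question_mark_term (a%:R + y)^-1) N.+1 =
  2^-1 ^+ a - 2^-1 ^+ a * series (question_mark_term y) N.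
Proof.
move=> a0 /(partial_quotient_cons a)[q0 g].
rewrite /series /= big_nat_recl// {1}/question_mark_term q0 gtn_eqF//.
rewrite expr0 mul1r big_ord_recl big_ord0 addn0 q0; congr (_ + _).
rewrite -mulrN -sumrN mulr_sumr; apply: eq_bigr => k _.
rewrite /question_mark_term partial_quotientS g; case: ifP => _.
  by rewrite oppr0 mulr0.
rewrite big_ord_recl q0 exprD exprS mulN1r.
under eq_bigr => i _ do rewrite lift0 partial_quotientS g.
by ring.
Qed.

Lemma contfrac_ge0 (R : realType) s : 0 <= contfrac R s.
Proof. by elim: s => //= a s IH; rewrite invr_ge0 addr_ge0. Qed.

Lemma question_mark_sum0 (R : realType) N :
  series (question_mark_term (0 : R)) N = 0.
Proof.
have g0 k : iter k (@gauss R) 0 = 0.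
  by elim: k => //= k ->; rewrite /gauss invr0 truncn0 subr0.
rewrite /series /= big1// => k _.
by rewrite /question_mark_term /partial_quotient g0 invr0 truncn0.
Qed.

Lemma contfrac_lt1 (R : realType) s :
  all (ltn 0) s -> s != [:: 1%N] -> contfrac R s < 1.
Proof.
case: s => [|a s] /=; first by rewrite ltr01.
move=> /andP[a0 s0] sN1; rewrite invf_lt1; last first.
  by rewrite ltr_wpDr ?contfrac_ge0// ltr0n.
move: a0; rewrite leq_eqVlt => /predU1P[a1|a1]; last first.
  by rewrite ltr_wpDr ?contfrac_ge0// ltr1n.
case: s s0 sN1 => [_|b s /= /andP[b0 _] _]; first by rewrite -a1.
by rewrite -a1 ltrDl invr_gt0 ltr_wpDr ?contfrac_ge0// ltr0n.
Qed.

Definition question_mark_seq (R : realType) (s : seq nat) : R :=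
  \sum_(k < size s) (-1) ^+ k * 2^-1 ^+ sumn (take k.+1 s).

Lemma question_mark_seq_cons (R : realType) a s :
  question_mark_seq R (a :: s) =
  2^-1 ^+ a - 2^-1 ^+ a * question_mark_seq R s.
Proof.
rewrite /question_mark_seq /= big_ord_recl /= take0 addn0 mul1r.
congr (_ + _); rewrite -mulrN -sumrN mulr_sumr; apply: eq_bigr => k _.
by rewrite /bump leq0n add1n exprD exprS; ring.
Qed.

Lemma question_mark_contfrac_sum (R : realType) s N :
  all (ltn 0) s -> (size s <= N)%N ->
  series (question_mark_term (contfrac R s)) N = question_mark_seq R s.
Proof.
elim: s N => [|a s IH] N /=.
  by move=> _ _; rewrite question_mark_sum0 /question_mark_seq big_ord0.
move=> /andP[a0 s0]; case: N => // N sN.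
have [s1|sN1] := eqVneq s [:: 1%N]; last first.
  rewrite question_mark_sum_cons// ?contfrac_ge0 ?contfrac_lt1//.
  by rewrite IH// question_mark_seq_cons.
rewrite s1 !question_mark_seq_cons /= addr0 invr1 -(addr0 (a%:R + 1)).
rewrite natr1 question_mark_sum_cons ?lexx ?ltr01// question_mark_sum0.
by rewrite /question_mark_seq big_ord0 exprSr; lra.
Qed.

(* Each rational in ]0, 1[ has two such expansions, one of them ending in the
   digit 1; both give the same value. *)
Lemma question_mark_contfrac (R : realType) s :
  all (ltn 0) s ->
  question_mark (contfrac R s) =
  2 * \sum_(k < size s) (-1) ^+ k * 2^-1 ^+ sumn (take k.+1 s).
Proof.
move=> s0; congr (2 * _); apply/cvg_lim => //.
apply: (cvg_near_cst (question_mark_seq R s)).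
by exists (size s) => // N /=; exact: question_mark_contfrac_sum.
Qed.

Lemma contfrac_mkseq_bounds (R : realType) (a : nat -> nat) n :
  (forall k, 0 < a k)%N ->
  ((a 0)%:R + 1)^-1 <= contfrac R (mkseq a n.+2)
    <= (1 + ((a 1)%:R + 1)^-1)^-1.
Proof.
move=> a0; have le1 (b : nat -> nat) m : (forall k, 0 < b k)%N ->
    contfrac R (mkseq b m) <= 1.
  case: m => [|m] b0; first by rewrite ler01.
  rewrite /mkseq /= invf_le1; last first.
    by rewrite ltr_wpDr ?contfrac_ge0// ltr0n.
  by rewrite ler_wpDr ?contfrac_ge0// ler1n.
have inv_le (y z : R) : 0 < y -> y <= z -> z^-1 <= y^-1.
    by move=> y0 yz; rewrite lef_pV2// posrE (lt_le_trans y0).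
have posD (b : nat) (y : R) : (0 < b)%N -> 0 <= y -> 0 < b%:R + y.
  by move=> b0 y0; rewrite ltr_wpDr// ltr0n.
have E (b : nat -> nat) m : mkseq b m.+1 = b 0%N :: mkseq (b \o S) m.
  by rewrite /mkseq /= (iotaDl 1 0) -map_comp.
have C b s : contfrac R (b :: s) = (b%:R + contfrac R s)^-1 by [].
rewrite E C; apply/andP; split; apply/inv_le.
- by rewrite posD ?contfrac_ge0 //=.
- by rewrite lerD2l le1// => k /=.
- by rewrite ltr_wpDr// invr_ge0 addr_ge0.
rewrite lerD ?ler1n// E C; apply/inv_le.
- by rewrite posD ?contfrac_ge0 //=.
- by rewrite lerD2l le1// => k /=.
Qed.

Lemma partial_quotient_contfrac (R : realType) (a : nat -> nat) (x : R) :
  (forall k, 0 < a k)%N ->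
  contfrac R (mkseq a n) @[n --> \oo] --> x ->
  forall k, partial_quotient x k = a k.
Proof.
move=> a0 ax k.
have bnd (b : nat -> nat) (y : R) : (forall k, 0 < b k)%N ->
    contfrac R (mkseq b n) @[n --> \oo] --> y -> 0 < y < 1.
  move=> b0 byl; have by2 : contfrac R (mkseq b n.+2) @[n --> \oo] --> y.
    rewrite (cvg_shiftS (fun n => contfrac R (mkseq b n.+1))).
    by rewrite (cvg_shiftS (fun n => contfrac R (mkseq b n))).
  apply/andP; split.
    apply: (@lt_le_trans _ _ ((b 0%N)%:R + 1)^-1).
      by rewrite invr_gt0 ltr_wpDl.
    rewrite -(cvg_lim _ by2)//; apply: limr_ge; first exact: cvgP by2.
    by apply: nearW => n; have /andP[] := contfrac_mkseq_bounds R n b0.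
  apply: (@le_lt_trans _ _ (1 + ((b 1%N)%:R + 1)^-1)^-1).
    rewrite -(cvg_lim _ by2)//; apply: limr_le; first exact: cvgP by2.
    by apply: nearW => n; have /andP[] := contfrac_mkseq_bounds R n b0.
  have p : 0 < ((b 1%N)%:R + 1 : R)^-1 by rewrite invr_gt0 ltr_wpDl.
  by rewrite invf_lt1 ?ltrDl// addr_gt0.
have tail (b : nat -> nat) (y : R) : (forall k, 0 < b k)%N ->
    contfrac R (mkseq b n) @[n --> \oo] --> y ->
    0 <= y^-1 - (b 0%N)%:R < 1 /\
    contfrac R (mkseq (b \o S) n) @[n --> \oo] --> y^-1 - (b 0%N)%:R.
  move=> b0 byl; have /andP[y0 _] := bnd _ _ b0 byl.
  have by1 : contfrac R (mkseq b n.+1) @[n --> \oo] --> y.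
    by rewrite (cvg_shiftS (fun n => contfrac R (mkseq b n))).
  have ty : contfrac R (mkseq (b \o S) n) @[n --> \oo] --> y^-1 - (b 0%N)%:R.
    have -> : (fun n => contfrac R (mkseq (b \o S) n)) =
              (fun n => (contfrac R (mkseq b n.+1))^-1 - (b 0%N)%:R).
      apply/funext => n; rewrite /mkseq /= (iotaDl 1 0) -map_comp.
      by rewrite invrK addrC addKr.
    by apply: cvgB; [exact: cvgV (lt0r_neq0 y0) by1|exact: cvg_cst].
  split=> //; have /andP[t0 ->] := bnd _ _ (fun k => b0 k.+1) ty.
  by rewrite ltW.
elim: k a x a0 ax => [|k IH] a x a0 ax; have [y01 ty] := tail _ _ a0 ax;
  have [] := partial_quotient_cons (a 0%N) y01; rewrite addrC subrK invrK//.
by move=> _ g; rewrite partial_quotientS g (IH (a \o S)) //=.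
Qed.

Lemma question_mark_infinite_contfrac (R : realType) (a : nat -> nat) (x : R) :
  (forall k, 0 < a k)%N ->
  contfrac R (mkseq a n) @[n --> \oo] --> x ->
  question_mark x =
  2 * limn (fun N =>
    \sum_(k < N) (-1) ^+ k * 2^-1 ^+ (\sum_(i < k.+1) a i)%N : R).
Proof.
move=> a0 ax; congr (2 * _); congr (limn _); apply/funext => N.
rewrite /series /= big_mkord; apply: eq_bigr => k _.
have q := partial_quotient_contfrac a0 ax.
rewrite /question_mark_term q gtn_eqF//; congr (_ * _ ^+ _).
by apply: eq_bigr => i _; rewrite q.
Qed.

(* Main.v *)
From HB Require Import structures.
Require Import Defs.
From mathcomp Require Import all_boot all_order all_algebra.
From mathcomp Require Import all_classical all_reals all_analysis.
From mathcomp Require Import ring lra zify.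
Import Order.TTheory GRing.Theory Num.Theory.
Import numFieldNormedType.Exports.

Local Open Scope classical_set_scope.
Local Open Scope ring_scope.

(** Let [c n x] be the number of fractions of row [n] that are less than [x].
    The two maps generating the tree give
      [c (n+1) x = c n (x / (1 - x))]       for [0 <= x <= 1/2],
      [c (n+1) x = 2^n + c n (2 - 1/x)]     for [1/2 <= x <= 1],
    and [2^n ?(x)] satisfies the same recursion, because
    [?(x) = ?(x / (1 - x)) / 2] and [?(x) = 1/2 + ?(2 - 1/x) / 2] respectively.
    Hence [|c n x - 2^n ?(x)| <= 1] for all [n]; summing over the first [N]
    rows, [Pr (X_N < x)] differs from [?(x)] by at most [N / (2^N - 1)].

    The same bound makes ? nondecreasing, as [c n] is, and continuous, as [c n]
    varies by at most 1 near every point since row [n] has no repetition. The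
    law of X is then the Lebesgue-Stieltjes measure of ?, which has no atoms. *)

(** * Convergence and functional equations of the question mark function *)

Section question_mark_theory.
Context {R : realType}.
Implicit Types x y w : R.

(** Peels off the first digit: [y] is the Gauss image of [x], so facts about partial sums can be
    proved by induction on their length. *)
Lemma itv01_inv_digit x : 0 < x <= 1 ->
  exists a y, [/\ (0 < a)%N, 0 <= y < 1 & x = (a%:R + y)^-1].
Proof.
move=> /andP[x0 x1]; have xV1 : 1 <= x^-1 by rewrite invf_ge1.
have /truncn_itv/andP[lo hi] : 0 <= x^-1 by exact: le_trans xV1.
exists (Num.truncn x^-1), (x^-1 - (Num.truncn x^-1)%:R); split.
- by rewrite truncn_gt0.
- by rewrite subr_ge0 lo ltrBlDl natr1.
- by rewrite addrC subrK invrK.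
Qed.

Lemma question_mark_termE x k : question_mark_term x k =
  series (question_mark_term x) k.+1 - series (question_mark_term x) k.
Proof. by rewrite /series /= big_nat_recr//= addrAC subrr add0r. Qed.

Lemma question_mark_term0 k : question_mark_term (0 : R) k = 0.
Proof. by rewrite question_mark_termE !question_mark_sum0 subrr. Qed.

(** Prepending a digit [a] shifts the terms by one index and multiplies them by [- 2^-a], of size at
    most 1/2. The geometric bound gives absolute convergence. *)
Lemma question_mark_term_bound x k :
  0 <= x <= 1 -> `|question_mark_term x k| <= 2^-1 ^+ k.
Proof.
elim: k x => [|k IH] x /andP[]; rewrite le_eqVlt => /predU1P[<- _|x0 x1];
  rewrite ?question_mark_term0 ?normr0 ?exprn_ge0//.
  rewrite /question_mark_term; case: ifP; rewrite ?normr0//.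
  by rewrite mul1r normrX ger0_norm// exprn_ile1//; lra.
have [a [y [a0 y01 ->]]] := itv01_inv_digit _ (introT andP (conj x0 x1)).
have sum_cons := question_mark_sum_cons _ a0 y01.
have -> : question_mark_term (a%:R + y)^-1 k.+1 =
    - (2^-1 ^+ a * question_mark_term y k).
  by rewrite !question_mark_termE !sum_cons; ring.
rewrite normrN normrM exprS ler_pM// ?IH//; last first.
  by case/andP: y01 => -> /ltW.
rewrite ger0_norm ?exprn_ge0// -[leRHS]expr1 ler_wiXn2l//; lra.
Qed.

Lemma is_cvg_question_mark x :
  0 <= x <= 1 -> cvgn (series (question_mark_term x)).
Proof.
move=> x01; apply: normed_cvg.
apply: (@series_le_cvg _ _ (geometric 1 2^-1)) => [n|n|n|] /=.
- exact: normr_ge0.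
- by rewrite mul1r exprn_ge0.
- by rewrite mul1r question_mark_term_bound.
- by apply: is_cvg_geometric_series; rewrite ger0_norm; lra.
Qed.

(** Prepending a digit [a > 0] turns a partial sum S into [2^-a] (1 - S), a map sending [0, 1/2]
    into itself. *)
Lemma question_mark_sum_bounds x N :
  0 <= x <= 1 -> 0 <= series (question_mark_term x) N <= 2^-1.
Proof.
elim: N x => [|N IH] x x01; first by rewrite /series /= big_geq//; lra.
case/andP: x01; rewrite le_eqVlt => /predU1P[<- _|x0 x1].
  by rewrite question_mark_sum0; lra.
have [a [y [a0 y01 ->]]] := itv01_inv_digit _ (introT andP (conj x0 x1)).
rewrite question_mark_sum_cons//.
have /IH : 0 <= y <= 1 by case/andP: y01 => -> /ltW.
have : 2^-1 ^+ a <= 2^-1 :> R by rewrite -[leRHS]expr1 ler_wiXn2l//; lra.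
have : 0 <= 2^-1 ^+ a :> R by rewrite exprn_ge0.
nra.
Qed.

Lemma question_mark_bounds x : 0 <= x <= 1 -> 0 <= question_mark x <= 1.
Proof.
move=> x01; have cx := is_cvg_question_mark _ x01.
have lo : 0 <= limn (series (question_mark_term x)).
  apply: limr_ge => //; apply: nearW => N.
  by case/andP: (question_mark_sum_bounds _ N x01).
have hi : limn (series (question_mark_term x)) <= 2^-1.
  apply: limr_le => //; apply: nearW => N.
  by case/andP: (question_mark_sum_bounds _ N x01).
by rewrite /question_mark; lra.
Qed.

Lemma question_mark0 : question_mark (0 : R) = 0.
Proof.
by have := @question_mark_contfrac R [::] isT; rewrite big_ord0 mulr0.
Qed.

Lemma question_mark1 : question_mark (1 : R) = 1.
Proof.
have := @question_mark_contfrac R [:: 1%N] isT.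
by rewrite big_ord_recl big_ord0 /= !addr0 invr1 mul1r => ->; lra.
Qed.

Lemma question_mark_cons (a : nat) y : (0 < a)%N -> 0 <= y < 1 ->
  question_mark (a%:R + y)^-1 = 2 * 2^-1 ^+ a - 2^-1 ^+ a * question_mark y.
Proof.
move=> a0 y01; rewrite /question_mark.
have cy : cvgn (series (question_mark_term y)).
  by apply: is_cvg_question_mark; case/andP: y01 => -> /ltW.
suff -> : limn (series (question_mark_term (a%:R + y)^-1)) =
    2^-1 ^+ a - 2^-1 ^+ a * limn (series (question_mark_term y)) by ring.
(* The new digit adds one term, so the sums for the left side are taken from index 1 on. *)
apply/cvg_lim => //; rewrite -cvg_shiftS /=.
under eq_fun do rewrite question_mark_sum_cons//.
by apply: cvgB; [exact: cvg_cst | exact: cvgMl_tmp].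
Qed.

(** For 0 < x <= 1/2 the first digit is at least 2, and x / (1 - x) has the same expansion with that
    digit lowered by one. *)
Lemma question_mark_le_half x : 0 <= x <= 2^-1 ->
  question_mark x = 2^-1 * question_mark (x / (1 - x)).
Proof.
move=> /andP[]; rewrite le_eqVlt => /predU1P[<- _|x0 x2].
  by rewrite mul0r question_mark0 mulr0.
have [|a [y [a0 y01 xE]]] := itv01_inv_digit x; first by apply/andP; lra.
have d0 : 0 < a%:R + y by rewrite -invr_gt0 -xE.
have a1 : (1 < a)%N.
  rewrite -(ltr_nat R); suff : 2 <= a%:R + y by lra.
  by rewrite -(@lef_pV2 _ _ 2) ?posrE// -xE.
case: a a1 a0 xE d0 => // a a1 _ -> d0.
have d1 : 0 < a%:R + y by rewrite ltr_wpDr// ?ltr0n//; lra.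
have -> : (a.+1%:R + y)^-1 / (1 - (a.+1%:R + y)^-1) = (a%:R + y)^-1.
  by rewrite -(natr1 a) in d0 *; field; lra.
by rewrite !question_mark_cons// exprS; lra.
Qed.

Lemma question_mark_inv_1D w : 0 <= w <= 1 ->
  question_mark (1 + w)^-1 = 1 - 2^-1 * question_mark w.
Proof.
move=> /andP[w0]; rewrite le_eqVlt => /predU1P[->|w1].
  (* At w = 1 the remainder leaves [0, 1[, so 1/2 is read as [0; 2] rather than [0; 1, 1]. *)
  have -> : 1 + 1 = 2%:R + 0 :> R by lra.
  rewrite question_mark_cons ?lexx ?ltr01//.
  by rewrite question_mark0 question_mark1 exprSr; lra.
by rewrite -[1 in LHS]/(1%:R) question_mark_cons ?w0// expr1; lra.
Qed.

(** For z <= 1/2, 1 - z = 1 / (1 + w) with w = z / (1 - z), and ?(w) = 2 ?(z). The other half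
    follows on replacing x by 1 - x. *)
Lemma question_mark_onem x : 0 <= x <= 1 ->
  question_mark (1 - x) = 1 - question_mark x.
Proof.
suff half (z : R) : 0 <= z <= 2^-1 ->
    question_mark (1 - z) = 1 - question_mark z.
  move=> x01; have [x2|x2] := lerP x 2^-1; first by apply: half; lra.
  by have := half (1 - x); rewrite subKr => ->; lra.
move=> /andP[z0 z2]; rewrite (question_mark_le_half z) ?z0//.
rewrite -question_mark_inv_1D; first by congr question_mark; field; lra.
by rewrite divr_ge0 ?ler_pdivrMr; lra.
Qed.

(** With w = 1/x - 1, x = 1 / (1 + w) and 2 - 1/x = 1 - w, so the symmetry ?(1 - w) = 1 - ?(w)
    applies. *)
Lemma question_mark_ge_half x : 2^-1 <= x <= 1 ->
  question_mark x = 2^-1 + 2^-1 * question_mark (2 - x^-1).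
Proof.
move=> /andP[x2 x1]; have x0 : 0 < x by lra.
have y01 : 0 <= x^-1 - 1 <= 1.
  by rewrite subr_ge0 invf_ge1 ?x1//= lerBlDr -[leRHS]invrK lef_pV2 ?posrE//.
have -> : 2 - x^-1 = 1 - (x^-1 - 1) by lra.
rewrite question_mark_onem//.
have := question_mark_inv_1D _ y01.
by rewrite addrC subrK invrK => ->; lra.
Qed.
End question_mark_theory.

(** * Counting in one row; monotonicity and continuity of the question mark function *)

Section farey_theory.
Context {R : realType}.
Implicit Types x y : R.

Lemma size_farey_row n : size (farey_row R n) = (2 ^ n)%N.
Proof.
by elim: n => //= n IH; rewrite size_cat !size_map IH addnn expnS mul2n.
Qed.

Lemma farey_row_itv n y : y \in farey_row R n -> 0 < y < 1.
Proof.
elim: n y => [y|n IH y] /=; first by rewrite inE => /eqP ->; lra.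
rewrite mem_cat => /orP[] /mapP[z /IH /andP[z0 z1] ->].
  by rewrite divr_gt0 ?ltr_pdivrMr//=; lra.
by rewrite invr_gt0 invf_lt1; lra.
Qed.

(** Both maps are injective on ]0, 1[, and their images lie on opposite sides of 1/2. *)
Lemma farey_row_uniq n : uniq (farey_row R n).
Proof.
elim: n => //= n IH; rewrite cat_uniq !map_inj_in_uniq ?IH /= ?andbT.
- apply/hasPn => _ /mapP[y /farey_row_itv /andP[y0 y1] ->].
  apply/mapP => -[z /farey_row_itv /andP[z0 z1]].
  suff : z / (1 + z) < (2 - y)^-1 by move=> /[swap] ->; rewrite ltxx.
  apply: (@lt_trans _ _ 2^-1); first by rewrite ltr_pdivrMr; lra.
  by rewrite ltf_pV2 ?posrE; lra.
- by move=> y z _ _ /invr_inj; lra.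
- move=> y z /farey_row_itv/andP[y0 y1] /farey_row_itv/andP[z0 z1].
  by move=> /eqP; rewrite eqr_div ?lt0r_neq0//; [move/eqP; lra|lra|lra].
Qed.

Lemma count_farey_rowS_le_half n x : 0 <= x <= 2^-1 ->
  count (< x) (farey_row R n.+1) = count (< (x / (1 - x))%R) (farey_row R n).
Proof.
move=> /andP[x0 x2]; rewrite /= count_cat !count_map.
rewrite [X in (_ + X)%N](_ : _ = 0%N) ?addn0.
  apply: eq_in_count => y /farey_row_itv/andP[y0 y1] /=.
  by rewrite ltr_pdivrMr ?ltr_pdivlMr; lra.
apply/eqP; rewrite -leqn0 leqNgt -has_count; apply/hasPn.
move=> y /farey_row_itv/andP[y0 y1] /=; rewrite -leNgt.
by apply: (le_trans x2); rewrite lef_pV2 ?posrE; lra.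
Qed.

Lemma count_farey_rowS_ge_half n x : 2^-1 <= x <= 1 ->
  count (< x) (farey_row R n.+1) =
  (2 ^ n + count (< (2 - x^-1)%R) (farey_row R n))%N.
Proof.
move=> /andP[x2 x1]; have x0 : 0 < x by lra.
rewrite /= count_cat !count_map; congr (_ + _)%N.
  rewrite -size_farey_row; apply/eqP; rewrite -all_count; apply/allP.
  move=> y /farey_row_itv/andP[y0 y1] /=.
  by apply: lt_le_trans x2; rewrite ltr_pdivrMr; lra.
apply: eq_in_count => y /farey_row_itv/andP[y0 y1] /=.
rewrite -[x in LHS]invrK ltf_pV2 ?posrE ?invr_gt0//; lra.
Qed.

(** The error at [x] in row n + 1 equals the error in row n at the transformed point, so the bound
    for row 0 persists. *)
Lemma count_farey_row_question_mark n x : 0 <= x <= 1 ->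
  `|(count (< x) (farey_row R n))%:R - 2 ^+ n * question_mark x| <= 1.
Proof.
elim: n x => [|n IH] x /andP[x0 x1].
  have := question_mark_bounds x; rewrite x0 x1 => /(_ isT) q01.
  by rewrite /= addn0 ler_norml; case: (_ < _) => /=; lra.
have [x2|x2] := lerP x 2^-1.
  rewrite count_farey_rowS_le_half ?x0// question_mark_le_half ?x0//.
  rewrite exprS mulrACA divff ?mul1r ?IH//.
  by rewrite divr_ge0 ?ler_pdivrMr; lra.
rewrite count_farey_rowS_ge_half ?(ltW x2)// question_mark_ge_half ?(ltW x2)//.
rewrite exprS natrD natrX.
set q := question_mark _; set c := (count _ _)%:R.
have -> : 2 ^+ n + c - 2 * 2 ^+ n * (2^-1 + 2^-1 * q) = c - 2 ^+ n * q by field.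
apply: IH; have xV1 : 1 <= x^-1 by rewrite invf_ge1//; lra.
have : x^-1 <= 2 by rewrite -[leRHS]invrK lef_pV2 ?posrE; lra.
lra.
Qed.

(** A Lebesgue-Stieltjes measure needs a cumulative function on the whole line, so ? is continued by
    0 on the left and 1 on the right. *)
Definition question_mark_ext x := question_mark (Num.max 0 (Num.min x 1)).

Lemma question_mark_ext_id x :
  0 <= x <= 1 -> question_mark_ext x = question_mark x.
Proof.
by move=> /andP[x0 x1]; rewrite /question_mark_ext (min_idPl x1) (max_idPr x0).
Qed.

Lemma question_mark_ext_le0 x : x <= 0 -> question_mark_ext x = 0.
Proof.
move=> x0; rewrite /question_mark_ext.
by rewrite (min_idPl _) ?(max_idPl _) ?question_mark0//; lra.
Qed.

Lemma question_mark_ext_ge1 x : 1 <= x -> question_mark_ext x = 1.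
Proof.
move=> x1; rewrite /question_mark_ext.
by rewrite (min_idPr _) ?(max_idPr _) ?question_mark1//; lra.
Qed.

Lemma count_farey_row_question_mark_ext n x :
  `|(count (< x) (farey_row R n))%:R - 2 ^+ n * question_mark_ext x| <= 1.
Proof.
have [x0|x0] := lerP x 0.
  rewrite question_mark_ext_le0// mulr0 subr0 (_ : count _ _ = 0%N) ?normr0//.
  apply/eqP; rewrite -leqn0 leqNgt -has_count; apply/hasPn.
  by move=> y /farey_row_itv/andP[y0 y1] /=; lra.
have [x1|x1] := lerP x 1; last first.
  rewrite question_mark_ext_ge1 ?(ltW x1)// mulr1 -natrX -size_farey_row.
  rewrite (_ : count _ _ = size (farey_row R n)) ?subrr ?normr0//.
  apply/eqP; rewrite -all_count; apply/allP.
  by move=> y /farey_row_itv/andP[y0 y1] /=; lra.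
by rewrite question_mark_ext_id ?count_farey_row_question_mark ?(ltW x0) ?x1.
Qed.

(** Removes the bounded counting error: an inequality scaled by every power of 2 survives only if it
    holds exactly. *)
Lemma le0_of_expr2_mul_bounded (d C : R) :
  (forall n, 2 ^+ n * d <= C) -> d <= 0.
Proof.
move=> dC; rewrite leNgt; apply/negP => d0.
have := dC (Num.truncn (C / d)).+1; apply/negP; rewrite -ltNge.
rewrite -ltr_pdivrMr//; apply: lt_trans (truncnS_gt _) _.
by rewrite -natrX ltr_nat ltn_expl.
Qed.

Lemma question_mark_ext_nondecreasing : nondecreasing question_mark_ext.
Proof.
move=> x y xy; rewrite -subr_le0; apply: (@le0_of_expr2_mul_bounded _ 2) => n.
have cxy : (count (< x) (farey_row R n))%:R <=
    (count (< y) (farey_row R n))%:R :> R.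
  by rewrite ler_nat; apply: sub_count => z /= /lt_le_trans; apply.
have := count_farey_row_question_mark_ext n x.
have := count_farey_row_question_mark_ext n y.
by rewrite !ler_norml; lra.
Qed.

Lemma near_eq_lt x y : y != x -> \forall z \near x, (y < z) = (y < x).
Proof.
rewrite neq_lt => /orP[yx|xy].
  by apply: filterS (lt_nbhsr yx) => z yz; rewrite yz yx.
by apply: filterS (lt_nbhsl xy) => z zy; rewrite !ltNge !ltW.
Qed.

(** Close enough to [x], only an entry equal to [x] can change sides, and there is at most one. *)
Lemma near_count_lt (s : seq R) x : uniq s ->
  \forall z \near x, `|(count (< z) s)%:R - (count (< x) s)%:R| <= 1 :> R.
Proof.
move=> us.
have : \forall z \near x, {in s, forall y, y != x -> (y < z) = (y < x)}.
  elim: s {us} => [|y s IH]; first by near=> z => u.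
  have [->|yx] := eqVneq y x.
    near=> z => u; rewrite inE => /predU1P[->|]; first by rewrite eqxx.
    by move: u; near: z.
  near=> z => u; rewrite inE => /predU1P[-> _|].
    by near: z; exact: near_eq_lt.
  by move: u; near: z.
apply: filterS => z szx.
have c1 : (count (pred1 x) s <= 1)%N.
  by rewrite count_uniq_mem//; case: (_ \in _).
have le (u v : R) : {in s, forall y, y != x -> (y < u) = (y < v)} ->
    (count (< u) s <= count (< v) s + 1)%N.
  move=> suv; apply: leq_trans (leq_add (leqnn _) c1).
  rewrite -count_predUI; apply: leq_trans (leq_addr _ _).
  rewrite -[leqLHS](@eq_in_count _ [pred y | (y \in s) && (y < u)]); last first.
    by move=> y ys /=; rewrite ys.
  apply: sub_count => y /= /andP[ys yu].
  by have [->|yx] := eqVneq y x; rewrite ?orbT// -suv ?yu.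
have h1 := le _ _ szx.
have h2 : (count (< x) s <= count (< z) s + 1)%N.
  by apply: le => y ys yx; rewrite szx.
move: h1 h2; rewrite -(ler_nat R) -[in X in _ -> X -> _](ler_nat R) !natrD.
by rewrite ler_norml; lra.
Unshelve. all: by end_near. Qed.

Lemma question_mark_ext_continuous : continuous question_mark_ext.
Proof.
move=> x; apply/cvgrPdist_le => e e0.
(* The 3 is one counting error at each of the two points plus a jump of the count by at most 1. *)
have [n ne] : exists n, 3 <= 2 ^+ n * e.
  apply: contrapT => /forallNP ne; suff : e <= 0 by lra.
  apply: (@le0_of_expr2_mul_bounded _ 3) => n; apply/ltW.
  by rewrite ltNge; apply/negP.
near=> z; pose F := question_mark_ext; rewrite -/(F x) -/(F z).
suff : `|2 ^+ n * F x - 2 ^+ n * F z| <= 2 ^+ n * e.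
  by rewrite -mulrBr normrM ger0_norm ?exprn_ge0// ler_pM2l// exprn_gt0.
have := count_farey_row_question_mark_ext n x.
have := count_farey_row_question_mark_ext n z.
have : `|(count (< z) (farey_row R n))%:R
         - (count (< x) (farey_row R n))%:R| <= 1 :> R.
  by near: z; exact: near_count_lt (farey_row_uniq n).
by rewrite !ler_norml -!/(F _); lra.
Unshelve. all: by end_near. Qed.
End farey_theory.

(** * Limit of the probabilities over the first rows *)

Section farey_limit.
Context {R : realType}.
Implicit Types x y : R.

Lemma farey_rowsS N : farey_rows R N.+1 = farey_rows R N ++ farey_row R N.
Proof.
by rewrite /farey_rows -[N.+1]addn1 iotaD map_cat flatten_cat /= add0n cats0.
Qed.

Lemma size_farey_rows N : (size (farey_rows R N)).+1 = (2 ^ N)%N.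
Proof.
elim: N => // N IH.
by rewrite farey_rowsS size_cat size_farey_row -addSn IH addnn expnS mul2n.
Qed.

Lemma count_farey_rows_question_mark N x : 0 <= x <= 1 ->
  `|(count (< x) (farey_rows R N))%:R -
    (size (farey_rows R N))%:R * question_mark x| <= N%:R.
Proof.
move=> x01; elim: N => [|N IH]; first by rewrite mul0r subrr normr0.
rewrite farey_rowsS count_cat size_cat !natrD size_farey_row natrX mulrDl.
rewrite opprD addrACA -(natr1 N) (le_trans (ler_normD _ _))// lerD//.
exact: count_farey_row_question_mark.
Qed.

(** Bounds the error N / (2^N - 1) by 2 / (N + 1), a multiple of the harmonic sequence. *)
Lemma mulnS_le_expn2 n : (n * n.+1 <= 2 * (2 ^ n).-1)%N.
Proof.
elim: n => // n IH; have := ltn_expl n (isT : (1 < 2)%N).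
by rewrite expnS; nia.
Qed.

Lemma count_ge_lt (s : seq R) x y : x <= y ->
  (count (fun z => x <= z < y) s)%:R =
  (count (< y) s)%:R - (count (< x) s)%:R :> R.
Proof.
move=> xy; apply/eqP; rewrite -subr_eq opprK -natrD eqr_nat; apply/eqP.
elim: s => //= z s IH; rewrite addnACA IH; congr (_ + _)%N.
by have [xz|zx] := leP x z => /=; [rewrite addn0|rewrite (lt_le_trans zx xy)].
Qed.

Lemma cvg_farey_prob x y : 0 <= x -> x <= y -> y <= 1 ->
  farey_prob N (fun z => x <= z < y) @[N --> \oo] -->
  question_mark y - question_mark x.
Proof.
move=> x0 xy y1; apply/cvgrPdist_le => e e0.
(* Each of the two endpoints contributes an error of at most 2 / (N + 1). *)
have h0 : (4 * harmonic N : R) @[N --> \oo] --> 0.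
  by rewrite -[X in _ --> X](mulr0 4); apply: cvgMl_tmp; exact: cvg_harmonic.
near=> N.
apply: (@le_trans _ _ (4 * harmonic N)); last first.
  by apply: le_trans (ler_norm _) _; near: N; exact: cvgr0_norm_le h0 _ e0.
have N0 : (0 < N)%N by near: N; exact: nbhs_infty_gt.
rewrite /farey_prob count_ge_lt// /harmonic /=.
have x01 : 0 <= x <= 1 by apply/andP; split; lra.
have y01 : 0 <= y <= 1 by apply/andP; split; lra.
have := count_farey_rows_question_mark N _ x01.
have := count_farey_rows_question_mark N _ y01.
have := mulnS_le_expn2 N; rewrite -size_farey_rows /= -(ler_nat R) !natrM.
set s := (size _)%:R; set cx := (count (< x) _)%:R; set cy := (count _ _)%:R.
move=> sN hy hx.
have N1 : 1 <= N%:R :> R by rewrite ler1n.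
have s0 : 0 < s by rewrite -(natr1 N) in sN; nra.
rewrite -(ler_pM2l s0) -[X in X * `|_|]gtr0_norm// -normrM.
rewrite mulrBr mulrCA divff ?gt_eqF// mulr1.
rewrite mulrCA mulrA ler_pdivlMr ?ltr0n//.
apply: (@le_trans _ _ ((N%:R + N%:R) * N.+1%:R)).
  by rewrite ler_pM2r ?ltr0n//; move: hx hy; rewrite !ler_norml; lra.
lra.
Unshelve. all: by end_near. Qed.

End farey_limit.

(** * The law of X as a Lebesgue-Stieltjes measure *)

Section farey_measure.
Context {R : realType}.

Let question_mark_ext_Ny : @question_mark_ext R x @[x --> -oo] --> (0 : R).
Proof.
apply: cvg_near_cst; near=> x.
by apply/question_mark_ext_le0; near: x; exact: nbhs_ninfty_le.
Unshelve. all: by end_near. Qed.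

Let question_mark_ext_y : @question_mark_ext R x @[x --> +oo] --> (1 : R).
Proof.
apply: cvg_near_cst; near=> x.
by apply/question_mark_ext_ge1; near: x; exact: nbhs_pinfty_ge.
Unshelve. all: by end_near. Qed.

HB.instance Definition _ := isCumulative.Build R _ R (@question_mark_ext R)
  question_mark_ext_nondecreasing
  (right_continuousW question_mark_ext_continuous).

HB.instance Definition _ := isCumulativeBounded.Build R 0 1
  (@question_mark_ext R) question_mark_ext_Ny question_mark_ext_y.

Definition farey_measure : probability (measurableTypeR R) R :=
  lebesgue_stieltjes_measure (@question_mark_ext R).

Lemma farey_measure_itvoc (a b : R) : a <= b ->
  farey_measure `]a, b]%classic =
  (question_mark_ext b - question_mark_ext a)%:E.
Proof.
move=> ab; rewrite /= /lebesgue_stieltjes_measure /measure_extension/=.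
by rewrite measurable_mu_extE/= ?wlength_itv_bnd//; exact: is_ocitv.
Qed.

(** The point lies in []a - d, a]], whose mass is small for small [d] by continuity. *)
Lemma farey_measure_set1 (a : R) : farey_measure [set a] = 0%E.
Proof.
apply/eqP; rewrite eq_le measure_ge0 andbT; apply/lee_addgt0Pr => e e0.
have [d d0 ad] : exists2 d, 0 < d &
    question_mark_ext a - question_mark_ext (a - d) <= e.
  have /cvgrPdist_le/(_ _ e0) := @question_mark_ext_continuous R a.
  move=> /nbhs_ballP[d /= d0 ad]; exists (d / 2); first by rewrite divr_gt0.
  apply: le_trans (ler_norm _) (ad _ _); rewrite /ball /= opprB addrC subrK.
  by rewrite ger0_norm; lra.
rewrite add0e; apply: (@le_trans _ _ (farey_measure `]a - d, a]%classic)).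
  apply: le_measure; rewrite ?inE//.
  by move=> _ ->; rewrite /= in_itv/= lexx andbT; lra.
by rewrite farey_measure_itvoc ?lee_fin//; lra.
Qed.

(** Adding [a] to []a, b]] or [b] to [[a, b[] gives the same closed interval, and points have mass
    0. *)
Lemma farey_measure_itvco (a b : R) : a <= b ->
  farey_measure `[a, b[%classic =
  (question_mark_ext b - question_mark_ext a)%:E.
Proof.
move=> ab; have U1 (A : set R) c : measurable A -> ~ A c ->
    farey_measure (c |` A) = farey_measure A.
  move=> mA Ac; rewrite measureU//; last first.
    by apply/seteqP; split=> // x [/= ->].
  by rewrite [X in (X + _)%E]farey_measure_set1 add0e.
have /predU1P[->|{}ab] : (a == b) || (a < b) by rewrite -le_eqVlt.
  by rewrite set_itvco0 measure0 subrr.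
rewrite -farey_measure_itvoc ?(ltW ab)//.
have E : a |` `]a, b]%classic = b |` `[a, b[%classic.
  by rewrite setU1itv ?bnd_simp ?(ltW ab)// [RHS]setUC setUitv1 ?bnd_simp ?ltW.
rewrite -[RHS](U1 _ a)//; last by rewrite /= in_itv/= ltxx.
by rewrite E U1//= in_itv/= ltxx andbF.
Qed.

Lemma farey_distribution_farey_measure : farey_distribution farey_measure.
Proof.
split.
  apply/eqP; rewrite eq_le probability_le1//=.
  (* The 1 is rewritten as the mass of []0, 1]], which is contained in [[0, 1]]. *)
  rewrite -[leLHS]/((1 : R)%:E) -[1 in leLHS]subr0.
  rewrite -[1 in leLHS](@question_mark_ext_ge1 R 1)//.
  rewrite -[0 in leLHS](@question_mark_ext_le0 R 0)//.
  rewrite -farey_measure_itvoc//; apply: le_measure; rewrite ?inE//.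
  exact: subset_itv_oc_cc.
move=> a b a0 ab b1; rewrite farey_measure_itvco//.
rewrite !question_mark_ext_id; [|lra|lra].
by apply/cvg_EFin; [exact: nearW|exact: cvg_farey_prob].
Qed.

End farey_measure.

Theorem mainTheorem1 (R : realType) :
  (exists mu : probability (measurableTypeR R) R, farey_distribution mu) /\
  (forall mu : probability (measurableTypeR R) R, farey_distribution mu ->
    forall a b : R, 0 <= a -> a <= b -> b <= 1 ->
      (question_mark b - question_mark a)%:E
      = (\int[mu]_(x in `[a, b[%classic) 1)%E).
Proof.
split; first by exists farey_measure; exact: farey_distribution_farey_measure.
move=> mu [_ muP] a b a0 ab b1.
(* The integral is the mass of [[a, b[], by hypothesis the limit of the probabilities; uniqueness of
   limits identifies it. *)
rewrite integral_cst//= mul1e; apply: cvg_unique (muP a b a0 ab b1) => //.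
by apply/cvg_EFin; [exact: nearW|exact: cvg_farey_prob].
Qed.
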